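(* For every $m\ge1$, the sequences $\big(\#R_n(1/2/\ldots/m)\big)_{n\ge0}$ and $\big(\#R_n(12\ldots m)\big)_{n\ge0}$ are P-recursive. Furthermore, for every partition $\pi$ of $[3]$, the sequence $\big(\#R_n(\pi)\big)_{n\ge0}$ is P-recursive.
   Context: $\Pi_n$ is the set of partitions of $[n]$. A partition $B_1/\ldots/B_k$ is in canonical order if $\min B_1<\cdots<\min B_k$; its restricted growth function is $\rho(\pi)=a_1\ldots a_n$ where $a_i$ is the index of the block containing $i$. A sequence contains $r$ if some subsequence standardizes (order-preserving relabeling of values onto $1,2,\ldots$) to $r$. $\sigma$ R-avoids $\pi$ if $\rho(\sigma)$ does not contain $\rho(\pi)$; $R_n(\pi)$ is the set of $\sigma\in\Pi_n$ R-avoiding $\pi$. A sequence $(a_n)$ is P-recursive if there are polynomials $P_0,\ldots,P_k$, not all zero, with $\sum_{i=0}^kP_i(n)a_{n+i}=0$ for all $n\ge0$. *)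

(* Defs.v *)
From mathcomp Require Import all_boot all_order all_algebra.
Set Implicit Arguments. Unset Strict Implicit. Unset Printing Implicit Defensive.
Import GRing.Theory.

Definition Pi_n (n : nat) : {set {set {set 'I_n}}} :=
  [set P : {set {set 'I_n}} | partition P [set: 'I_n]].

(* minimum element of a block (as a nat); n if the block is empty *)
Definition bmin (n : nat) (B : {set 'I_n}) : nat := \big[minn/n]_(j in B) (j : nat).

(* restricted growth function rho(P) = a_1 ... a_n, where a_i is the
   (1-based) index of the block containing i, blocks listed in canonical
   order (increasing minima). *)
Definition rgf (n : nat) (P : {set {set 'I_n}}) : seq nat :=
  [seq #|[set B in P | bmin B <= bmin (pblock P i)]| | i <- enum 'I_n].

Definition std (t : seq nat) : seq nat :=
  [seq (index x (sort leq (undup t))).+1 | x <- t].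

Definition contains (s r : seq nat) : bool :=
  [exists m : (size s).-tuple bool, std (mask m s) == r].

Definition R_n (n : nat) (m : nat) (pi : {set {set 'I_m}}) : {set {set {set 'I_n}}} :=
  [set sigma in Pi_n n | ~~ contains (rgf sigma) (rgf pi)].

Definition discrete_part (m : nat) : {set {set 'I_m}} := [set [set i] | i : 'I_m].
Definition one_block_part (m : nat) : {set {set 'I_m}} := [set [set: 'I_m]].

Definition P_recursive (a : nat -> nat) : Prop :=
  exists (k : nat) (P : nat -> {poly rat}),
    (exists2 i, i <= k & (P i != 0)%R) /\
    forall n : nat, (\sum_(i < k.+1) (P i).[n%:R] * (a (n + i))%:R = 0 :> rat)%R.

(* Main.v *)
Require Import Defs.
From mathcomp Require Import all_boot all_order all_algebra.
From mathcomp Require Import zify.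
Set Implicit Arguments. Unset Strict Implicit. Unset Printing Implicit Defensive.
Import GRing.Theory Num.Theory.

(** The map [rgf] is a bijection from the partitions of [n] onto the words whose
letters are positive and exceed the maximum of the preceding letters by at most
1, so each [#|R_n n pi|] counts such words avoiding one pattern.
- Avoiding 12...m means having maximum less than m.  The numbers of words of
  length n with each given maximum form a vector on which adding a letter acts
  by a fixed matrix, so Cayley-Hamilton gives a recurrence with constant
  coefficients.
- Avoiding 1^m means that all blocks have size less than m.  Deleting the block
  of one element gives a(n+1) = \sum_(j < m-1) 'C(n, j) a(n-j), whose
  coefficients are polynomials in n.
- The patterns 112, 121 and 122 are each avoided by twice as many words of
  length n+2 as of length n+1.  With M the maximum of w, the two children of w
  are w followed by 1, and 1 followed by w with all letters increased by 1, for 112;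
  wM and w(M+1) for 121; w1 and w(M+1) for 122. *)

(** * Standardization and containment *)

Lemma containsP s r :
  reflect (exists2 t, subseq t s & std t = r) (contains s r).
Proof.
apply: (iffP existsP) => [[m /eqP <-]|[_ /subseqP[m sz_m ->] <-]].
  by exists (mask m s) => //; apply: mask_subseq.
by exists (tcast sz_m (in_tuple m)); rewrite val_tcast.
Qed.

Lemma contains_subseq s s' r : subseq s s' -> contains s r -> contains s' r.
Proof.
move=> ss' /containsP[t ts <-]; apply/containsP.
by exists t => //; apply: subseq_trans ss'.
Qed.

Lemma size_std t : size (std t) = size t.
Proof. exact: size_map. Qed.

(** This order isomorphism is all that is needed to read back an occurrence: [std_const_inv] and
    [std3E] use comparisons alone. *)
Lemma leq_std t :
  {in t &, {mono (fun x => (index x (sort leq (undup t))).+1) : x y / x <= y}}.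
Proof.
have in_s x : x \in t -> x \in sort leq (undup t).
  by rewrite mem_sort mem_undup.
have srt : sorted leq (sort leq (undup t)) by apply: sort_sorted leq_total _.
move=> x y xt yt; rewrite ltnS; apply/idP/idP.
  by exact: sorted_leq_index leq_trans leqnn _ srt _ _ (in_s _ xt) (in_s _ yt).
move=> xy; rewrite leqNgt; apply/negP => yx.
have le_yx := sorted_ltn_index leq_trans srt _ _ (in_s _ yt) (in_s _ xt) yx.
have eyx : y = x by apply/eqP; rewrite eqn_leq le_yx xy.
by rewrite eyx ltnn in yx.
Qed.

Lemma std_map f t : {mono f : x y / x <= y} -> std (map f t) = std t.
Proof.
move=> f_mono; have f_inj : injective f by apply: incn_inj.
rewrite /std undup_map_inj // -(map_sort f_mono) -map_comp.
by apply: eq_map => x /=; rewrite index_map.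
Qed.

Lemma std_constant t : constant t -> std t = nseq (size t) 1.
Proof.
case: t => // x t /= /all_pred1P ->; rewrite size_nseq.
set n := size t; rewrite -[LHS]/(std (nseq n.+1 x)).
have un : undup (nseq n.+1 x) = [:: x].
  by elim: n => //= n ->; rewrite inE eqxx.
by rewrite /std un map_nseq [sort _ _]/= /= eqxx.
Qed.

Lemma std_const_inv t m : std t = nseq m 1 -> constant t.
Proof.
case: t => // x t tE; apply/allP => y yt /=.
have val1 z : z \in x :: t -> (index z (sort leq (undup (x :: t)))).+1 = 1.
  move=> zt; have: (index z (sort leq (undup (x :: t)))).+1 \in std (x :: t).
    by apply/mapP; exists z.
  by rewrite tE mem_nseq => /andP[_ /eqP].
have xt : x \in x :: t by rewrite mem_head.
have yt' : y \in x :: t by rewrite inE yt orbT.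
by rewrite eqn_leq -(leq_std xt yt') -(leq_std yt' xt) /= !val1.
Qed.

Lemma std_sorted t : sorted ltn t -> std t = iota 1 (size t).
Proof.
move=> t_srt; have t_uniq : uniq t.
  by apply: sorted_uniq t_srt => //; [exact: ltn_trans | exact: ltnn].
rewrite /std undup_id // sorted_sort //; last 2 first.
- exact: leq_trans.
- by apply: sub_sorted t_srt => a b; apply: ltnW.
apply: (@eq_from_nth _ 0); rewrite ?size_map ?size_iota // => i it.
by rewrite (nth_map 0) // nth_iota // index_uniq // add1n.
Qed.

Lemma contains_nseq s m : 0 < m ->
  contains s (nseq m 1) <-> exists x, m <= count_mem x s.
Proof.
move=> m_gt0; split=> [/containsP[t ts tE]|[x mx]].
  have tc := std_const_inv tE.
  have sz : size t = m by rewrite -size_std tE size_nseq.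
  case: t => [|x t] in ts tE tc sz *; first by rewrite -sz in m_gt0.
  exists x; apply: leq_trans (leq_count_subseq _ ts).
  by move: tc; rewrite -sz /= eqxx add1n ltnS all_count => /eqP ->.
apply/containsP; exists (nseq m x).
  apply: subseq_trans (filter_subseq (pred1 x) s).
  rewrite (all_pred1P _ _ (filter_all (pred1 x) s)) size_filter.
  by rewrite -(subnKC mx) nseqD prefix_subseq.
rewrite std_constant ?size_nseq //.
by case: (m) => //= k; apply/all_pred1P; rewrite size_nseq.
Qed.

(** Every comparison is given as a boolean equality, so that once [a], [b], [c] are numerals [lia]
    decides which letters of an occurrence coincide. *)
Lemma std3E t a b c : std t = [:: a; b; c] ->
  exists x y z, [/\ t = [:: x; y; z],
    ((x <= y) = (a <= b)) * ((y <= x) = (b <= a)),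
    ((x <= z) = (a <= c)) * ((z <= x) = (c <= a)) &
    ((y <= z) = (b <= c)) * ((z <= y) = (c <= b))]%type.
Proof.
move=> tE; have := leq_std (t := t).
have: size t = size (std t) by rewrite size_std.
case: t tE => [|x [|y [|z []]]] // tE _ mono; exists x, y, z.
move: tE; rewrite /std; set g := fun _ => _.+1 => -[<- <- <-].
by split=> //; split; rewrite [RHS]mono // !inE eqxx ?orbT.
Qed.

(* Two-letter patterns are images of words on {0, 1} under this map, which makes
   their standardization computable. *)
Definition bump_from (a b x : nat) : nat := if x is x'.+1 then b + x' else a.

Lemma bump_from_mono a b : a < b -> {mono bump_from a b : x y / x <= y}.
Proof. by move=> ab [|x] [|y] /=; lia. Qed.

Lemma contains112 s :
  contains s [:: 1; 1; 2] <-> exists x y, x < y /\ subseq [:: x; x; y] s.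
Proof.
split=> [/containsP[t ts /std3E[x [y [z [tE [xy yx] [xz zx] [yz zy]]]]]]|
  [x [y [xy xxy]]]].
  have eyx : y = x by lia.
  by rewrite eyx in tE; exists x, z; rewrite -tE; split=> //; lia.
apply/containsP; exists [:: x; x; y] => //.
have <- : map (bump_from x y) [:: 0; 0; 1] = [:: x; x; y] by rewrite /= addn0.
by rewrite std_map //; apply: bump_from_mono.
Qed.

Lemma contains121 s :
  contains s [:: 1; 2; 1] <-> exists x y, x < y /\ subseq [:: x; y; x] s.
Proof.
split=> [/containsP[t ts /std3E[x [y [z [tE [xy yx] [xz zx] [yz zy]]]]]]|
  [x [y [xy xyx]]]].
  have ezx : z = x by lia.
  by rewrite ezx in tE; exists x, y; rewrite -tE; split=> //; lia.
apply/containsP; exists [:: x; y; x] => //.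
have <- : map (bump_from x y) [:: 0; 1; 0] = [:: x; y; x] by rewrite /= addn0.
by rewrite std_map //; apply: bump_from_mono.
Qed.

Lemma contains122 s :
  contains s [:: 1; 2; 2] <-> exists x y, x < y /\ subseq [:: x; y; y] s.
Proof.
split=> [/containsP[t ts /std3E[x [y [z [tE [xy yx] [xz zx] [yz zy]]]]]]|
  [x [y [xy xyy]]]].
  have ezy : z = y by lia.
  by rewrite ezy in tE; exists x, y; rewrite -tE; split=> //; lia.
apply/containsP; exists [:: x; y; y] => //.
have <- : map (bump_from x y) [:: 0; 1; 1] = [:: x; y; y] by rewrite /= addn0.
by rewrite std_map //; apply: bump_from_mono.
Qed.

(** * Restricted growth functions *)

(** The accumulator [k] is the maximum of the letters already read; starting from 0 forces the first
    letter to be 1. *)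
Fixpoint is_rgf_from (k : nat) (w : seq nat) : bool :=
  if w is a :: w' then (0 < a <= k.+1) && is_rgf_from (maxn k a) w' else true.

Local Notation is_rgf := (is_rgf_from 0).
Local Notation wmax := (foldl maxn 0).

Lemma is_rgf_rcons k w a :
  is_rgf_from k (rcons w a) = is_rgf_from k w && (0 < a <= (foldl maxn k w).+1).
Proof. by elim: w k => [|b w IHw] k /=; rewrite ?andbT // IHw andbA. Qed.

Lemma is_rgf_pos w k : is_rgf_from k w -> all (leq 1) w.
Proof. by elim: w k => //= a w IHw k /andP[/andP[-> _] /IHw]. Qed.

(** Serves words 1 followed by [map S w]: after the leading 1 the running maximum is 1. Positivity
    matters, since a letter 0 would become an admissible 1. *)
Lemma is_rgf_mapS w k :
  all (leq 1) w -> is_rgf_from k.+1 (map S w) = is_rgf_from k w.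
Proof.
elim: w k => //= a w IHw k /andP[a_gt0 wpos].
by rewrite a_gt0 ltnS maxnSS IHw.
Qed.

Lemma wmax_rcons w a : wmax (rcons w a) = maxn (wmax w) a.
Proof. exact: foldl_rcons. Qed.

Lemma mem_is_rgf w x : is_rgf w -> (x \in w) = (0 < x <= wmax w).
Proof.
elim/last_ind: w => [|w a IHw]; first by rewrite in_nil; case: x.
rewrite is_rgf_rcons => /andP[w_rgf a_bnd].
by rewrite mem_rcons inE IHw // wmax_rcons; lia.
Qed.

(** A new maximum exceeds the old one by exactly 1, so first occurrences appear in increasing order
    without gaps. *)
Lemma iota_wmax_subseq w : is_rgf w -> subseq (iota 1 (wmax w)) w.
Proof.
elim/last_ind: w => [//|w a IHw]; rewrite is_rgf_rcons => /andP[/IHw{IHw} sub_w].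
move=> /andP[a_gt0]; rewrite wmax_rcons leq_eqVlt => /orP[/eqP ->|].
  rewrite (maxn_idPr (leqnSn _)) -cats1 -[(wmax w).+1]addn1 iotaD addnC.
  exact: cat_subseq.
rewrite ltnS => /maxn_idPl ->; apply: subseq_trans sub_w (subseq_rcons _ _).
Qed.

(* In a restricted growth function the value of each letter is forced by which
   earlier letters it equals. *)
Lemma is_rgf_inj v w : is_rgf v -> is_rgf w -> size v = size w ->
  (forall i j, i < size v -> j < size v ->
     (nth 0 v i == nth 0 v j) = (nth 0 w i == nth 0 w j)) ->
  v = w.
Proof.
elim/last_ind: v w => [|v a IHv] w; first by case: w.
case/lastP: w => [|w b]; rewrite ?size_rcons // !is_rgf_rcons.
move=> /andP[v_rgf a_bnd] /andP[w_rgf b_bnd] [sz_vw] ker.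
have evw : v = w.
  apply: IHv => // i j iv jv; have := ker i j (ltnW iv) (ltnW jv).
  by rewrite !nth_rcons -sz_vw iv jv.
have ker_last i : i < size v -> (nth 0 v i == a) = (nth 0 v i == b).
  move=> iv; have := ker i (size v) (ltnW iv) (leqnn _).
  by rewrite !nth_rcons -evw iv ltnn eqxx.
subst w; have mem_eq : (a \in v) = (b \in v).
  apply/idP/idP => [/(nthP 0)[i iv ai]|/(nthP 0)[i iv bi]].
    by have := ker_last i iv; rewrite ai eqxx => /esym/eqP <-; rewrite -ai mem_nth.
  by have := ker_last i iv; rewrite bi eqxx => /eqP <-; rewrite -bi mem_nth.
case av: (a \in v).
  have /(nthP 0)[i iv ai] := av.
  by have := ker_last i iv; rewrite ai eqxx => /esym/eqP ->.
(* Neither letter occurs in [v], so both must be [(wmax v).+1]. *)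
have := mem_eq; rewrite av => /esym; move: av; rewrite !(mem_is_rgf _ v_rgf).
by move=> ? ?; congr rcons; lia.
Qed.

Fixpoint rgf_words (n : nat) : seq (seq nat) :=
  if n is n'.+1 then
    [seq rcons w a | w <- rgf_words n', a <- iota 1 (wmax w).+1]
  else [:: [::]].

Lemma mem_rgf_words n w : (w \in rgf_words n) = is_rgf w && (size w == n).
Proof.
elim: n w => [|n IHn] w; first by rewrite inE; case: w => //= a w; rewrite andbF.
apply/idP/idP => [/allpairsPdep[v [a [vn an ->]]]|].
  move: vn an; rewrite IHn mem_iota is_rgf_rcons size_rcons eqSS.
  by move=> /andP[-> ->]; rewrite andbT.
case/lastP: w => [|w a]; rewrite ?andbF // is_rgf_rcons size_rcons eqSS.
move=> /andP[/andP[w_rgf a_bnd] sz_w]; apply/allpairsPdep; exists w, a.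
by rewrite IHn w_rgf mem_iota.
Qed.

Lemma rgf_words_uniq n : uniq (rgf_words n).
Proof.
elim: n => // n IHn; apply: (allpairs_uniq_dep (T := fun=> nat)) => //.
  by move=> w _; apply: iota_uniq.
by move=> [w a] [v b] /= _ _ /rcons_inj[-> ->].
Qed.

(** * The bijection between partitions and restricted growth functions *)

Section Letters.

Variables (n : nat) (P : {set {set 'I_n}}).

Lemma bmin_le (B : {set 'I_n}) i : i \in B -> bmin B <= i.
Proof.
rewrite /bmin => iB; have: i \in index_enum 'I_n by rewrite mem_index_enum.
elim: (index_enum _) => //= j s IHs; rewrite inE big_cons => /orP[/eqP <-|/IHs le_i].
  by rewrite iB geq_minl.
by case: ifP => // _; apply: leq_trans (geq_minr _ _) le_i.
Qed.

Lemma bmin_mem (B : {set 'I_n}) : B != set0 -> exists2 i, i \in B & bmin B = i.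
Proof.
move=> /set0Pn[j jB].
(* The default value [n] is carried through the induction and then excluded, because any element of
   [B] bounds [bmin B] strictly below [n]. *)
have: bmin B = n \/ exists2 i, i \in B & bmin B = i.
  rewrite /bmin; apply: (big_ind (fun x => x = n \/ exists2 i : 'I_n, i \in B & x = i)).
  - by left.
  - by move=> x y xP yP; rewrite /minn; case: ifP.
  - by move=> i iB; right; exists i.
by case=> // mB; have := leq_ltn_trans (bmin_le jB) (ltn_ord j); rewrite mB ltnn.
Qed.

Hypothesis partP : partition P [set: 'I_n].

Let letter i := #|[set B in P | bmin B <= bmin (pblock P i)]|.

Lemma bmin_inj : {in P &, injective (@bmin n)}.
Proof.
move=> B C BP CP eBC; have tiP := partition_trivIset partP.
have [i iB eB] := bmin_mem (partition_neq0 partP BP).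
have [j jC eC] := bmin_mem (partition_neq0 partP CP).
have eij : i = j by apply: val_inj; rewrite /= -eB -eC.
by rewrite -(def_pblock tiP BP iB) eij (def_pblock tiP CP jC).
Qed.

Lemma in_cover_all i : i \in cover P.
Proof. by rewrite (cover_partition partP) inE. Qed.

(** The sets of blocks counted by two letters are nested, so equal cardinalities make them equal;
    the two blocks then have the same minimum, which determines a block. *)
Lemma letter_eq i j : (letter i == letter j) = (pblock P i == pblock P j).
Proof.
apply/eqP/eqP => [|ePij]; last by rewrite /letter ePij.
wlog le_ij : i j / bmin (pblock P i) <= bmin (pblock P j) => [IH eij|eij].
  by case/orP: (leq_total (bmin (pblock P i)) (bmin (pblock P j))) => /IH -> .
have : [set B in P | bmin B <= bmin (pblock P i)]
        == [set B in P | bmin B <= bmin (pblock P j)].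
  rewrite eqEcard -/(letter i) -/(letter j) eij leqnn andbT.
  apply/subsetP => B; rewrite !inE => /andP[-> /= BI].
  exact: leq_trans BI le_ij.
have Pi k : pblock P k \in P by rewrite pblock_mem ?in_cover_all.
move=> /eqP/setP/(_ (pblock P j)); rewrite !inE Pi leqnn /= => le_ji.
by apply: bmin_inj => //; apply/eqP; rewrite eqn_leq le_ij.
Qed.

Lemma size_rgf : size (rgf P) = n.
Proof. by rewrite size_map size_enum_ord. Qed.

Lemma nth_rgf (i : 'I_n) : nth 0 (rgf P) i = letter i.
Proof. by rewrite (nth_map i) ?size_enum_ord // nth_ord_enum. Qed.

Let leaders k := #|[set B in P | bmin B < k]|.

(** The running maximum is the number of blocks opened so far. Position [k] either opens a block,
    and its letter is the next integer, or lies in an opened block, and its letter is at most that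
    number. *)
Lemma rgf_prefix k : k <= n ->
  is_rgf (take k (rgf P)) && (wmax (take k (rgf P)) == leaders k).
Proof.
elim: k => [|k IHk] kn.
  by rewrite take0 /= eq_sym cards_eq0; apply/eqP/setP => B; rewrite !inE ltn0 andbF.
have /andP[w_rgf /eqP w_max] := IHk (ltnW kn).
rewrite (take_nth 0) ?size_rgf // is_rgf_rcons wmax_rcons w_rgf w_max.
have Pi j : pblock P j \in P by rewrite pblock_mem ?in_cover_all.
have iPi j : j \in pblock P j by rewrite mem_pblock in_cover_all.
have tiP := partition_trivIset partP.
pose i := Ordinal kn; rewrite (nth_rgf i) /=.
have letter_gt0 : 0 < letter i.
  by apply/card_gt0P; exists (pblock P i); rewrite !inE Pi leqnn.
have := bmin_le (iPi i); rewrite leq_eqVlt => /orP[/eqP lead_i|lt_i].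
  have letterE : letter i = leaders k.+1.
    by apply: eq_card => B; rewrite !inE lead_i ltnS.
  have leadersE : leaders k.+1 = (leaders k).+1.
    rewrite /leaders (cardsD1 (pblock P i)) !inE Pi lead_i ltnS leqnn /= add1n.
    congr S; apply: eq_card => B; rewrite !inE ltnS [in RHS]ltn_neqAle.
    case BP: (B \in P); rewrite ?andbF //=; congr (~~ _ && _).
    by apply/eqP/eqP => [->|eB]; [|apply: bmin_inj; rewrite ?eB].
  by rewrite letterE leadersE; lia.
have letter_le : letter i <= leaders k.
  apply/subset_leq_card/subsetP => B; rewrite !inE => /andP[-> /=].
  by move=> le_B; apply: leq_ltn_trans lt_i.
have leadersE : leaders k.+1 = leaders k.
  apply: eq_card => B; rewrite !inE ltnS leq_eqVlt; case BP: (B \in P) => //=.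
  case: eqP => //= eB; have [j jB ej] := bmin_mem (partition_neq0 partP BP).
  have eij : j = i by apply: val_inj; rewrite /= -ej eB.
  by move: lt_i; rewrite -{1}eij (def_pblock tiP BP jB) eB ltnn.
by rewrite leadersE; lia.
Qed.

Lemma rgf_is_rgf : is_rgf (rgf P).
Proof. by have /andP[] := rgf_prefix (leqnn n); rewrite -{1}size_rgf take_size. Qed.

Lemma nth_rgf_eq (i j : 'I_n) :
  (nth 0 (rgf P) i == nth 0 (rgf P) j) = (pblock P i == pblock P j).
Proof. by rewrite !nth_rgf letter_eq. Qed.

End Letters.

(** A partition is recovered from its relation of lying in the same block, which is equality of
    letters. *)
Lemma rgf_inj n : {in Pi_n n &, injective (@rgf n)}.
Proof.
move=> P Q; rewrite !inE => partP partQ ePQ.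
rewrite -(preim_partition_pblock partP) -(preim_partition_pblock partQ).
apply: eq_in_imset => i _; apply/setP => j; rewrite !inE.
by rewrite -!nth_rgf_eq // ePQ.
Qed.

Lemma rgf_surj n w : w \in rgf_words n -> exists2 P, P \in Pi_n n & rgf P = w.
Proof.
rewrite mem_rgf_words => /andP[w_rgf /eqP sz_w].
(* The blocks are the sets of positions with equal letters; [rgf P] then has the same coincidences
   of letters as [w], and [is_rgf_inj] concludes. *)
pose f (i : 'I_n) := nth 0 w i; pose P := preim_partition f [set: 'I_n].
have partP : partition P [set: 'I_n] by apply: preim_partitionP.
exists P; rewrite ?inE //; apply: is_rgf_inj; rewrite ?rgf_is_rgf ?size_rgf //.
move=> i j ilt jlt.
rewrite (nth_rgf_eq partP (Ordinal ilt) (Ordinal jlt)).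
rewrite (eq_pblock _ (partition_trivIset partP)) ?in_cover_all //.
rewrite pblock_equivalence_partition ?inE //.
by move=> x y z _ _ _; split=> //= /eqP ->.
Qed.

Lemma card_R_n n m (pi : {set {set 'I_m}}) :
  #|R_n n pi| = count (fun w => ~~ contains w (rgf pi)) (rgf_words n).
Proof.
rewrite -size_filter cardE -(size_map (@rgf n)); apply/perm_size/uniq_perm.
- rewrite map_inj_in_uniq ?enum_uniq // => P Q.
  rewrite !mem_enum inE => /andP[PP _]; rewrite inE => /andP[QQ _].
  exact: rgf_inj.
- by rewrite filter_uniq ?rgf_words_uniq.
move=> w; rewrite mem_filter; apply/mapP/andP => [[P]|[av /rgf_surj[P PP eP]]].
  rewrite mem_enum inE => /andP[PP av] ->; split=> //.
  by move: PP; rewrite inE mem_rgf_words => PP; rewrite rgf_is_rgf // size_rgf eqxx.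
by exists P; rewrite ?mem_enum // inE PP eP.
Qed.

(** * Words of bounded maximum *)

Lemma uniq_is_rgf w : is_rgf w -> uniq w -> w = iota 1 (size w).
Proof.
move=> w_rgf w_uniq; have sub_w := iota_wmax_subseq w_rgf.
have le_sz : size w <= size (iota 1 (wmax w)).
  by apply: uniq_leq_size => // x; rewrite (mem_is_rgf _ w_rgf) mem_iota add1n ltnS.
have eqw : iota 1 (wmax w) = w.
  by apply/eqP; rewrite -(geq_leqif (size_subseq_leqif sub_w)).
by rewrite -{1}eqw -{2}eqw size_iota.
Qed.

Lemma discrete_partE m : discrete_part m = preim_partition id [set: 'I_m].
Proof.
have eq1 (i : 'I_m) : [set i] = [set j in [set: 'I_m] | i == j].
  by apply/setP => j; rewrite !inE eq_sym.
by apply/setP => B; apply/imsetP/imsetP => -[i _ ->]; exists i; rewrite ?eq1 ?inE.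
Qed.

Lemma discrete_partP m : partition (discrete_part m) [set: 'I_m].
Proof. by rewrite discrete_partE preim_partitionP. Qed.

Lemma rgf_discrete m : rgf (discrete_part m) = iota 1 m.
Proof.
have partP := discrete_partP m.
rewrite (uniq_is_rgf (rgf_is_rgf partP)) ?size_rgf //.
apply/(uniqP 0) => i j; rewrite !inE size_rgf => ilt jlt /eqP.
rewrite (nth_rgf_eq partP (Ordinal ilt) (Ordinal jlt)).
rewrite (eq_pblock _ (partition_trivIset partP)) ?in_cover_all //.
rewrite (def_pblock (partition_trivIset partP) (B := [set Ordinal ilt])) ?inE //.
  by move=> /eqP[].
by apply/imsetP; exists (Ordinal ilt).
Qed.

Lemma one_block_partP m : 0 < m -> partition (one_block_part m) [set: 'I_m].
Proof.
case: m => // m _; rewrite /partition /cover big_set1 eqxx /trivIset /cover.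
by rewrite !big_set1 eqxx inE eq_sym -card_gt0 cardsT card_ord.
Qed.

Lemma rgf_one_block m : 0 < m -> rgf (one_block_part m) = nseq m 1.
Proof.
move=> m_gt0; have partP := one_block_partP m_gt0.
have w_rgf := rgf_is_rgf partP; have sz_w := size_rgf (one_block_part m).
have const_w : rgf (one_block_part m) = nseq m (nth 0 (rgf (one_block_part m)) 0).
  apply: (@eq_from_nth _ 0); rewrite ?size_nseq // sz_w => i ilt; apply/eqP.
  rewrite nth_nseq ilt (nth_rgf_eq partP (Ordinal ilt) (Ordinal m_gt0)).
  rewrite (eq_pblock _ (partition_trivIset partP)) ?in_cover_all //.
  rewrite (def_pblock (partition_trivIset partP) (B := setT)) ?inE //.
rewrite const_w; congr nseq; move: w_rgf; rewrite {1}const_w.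
by case: (m) m_gt0 => //= k _; case: (nth _ _ _) => [|[]].
Qed.

(** An occurrence has [m] distinct letters, all between 1 and [wmax w]; conversely 1, ..., [m] is
    itself a subsequence. *)
Lemma contains_iota w m : is_rgf w -> contains w (iota 1 m) = (m <= wmax w).
Proof.
move=> w_rgf; apply/idP/idP => [/containsP[t tw tE]|mw].
  have t_uniq : uniq t.
    apply: (@map_uniq _ _ (fun x => (index x (sort leq (undup t))).+1)).
    by rewrite -/(std t) tE iota_uniq.
  rewrite -[m](size_iota 1) -tE size_std -[wmax w](size_iota 1).
  apply: uniq_leq_size => // x /(mem_subseq tw).
  by rewrite (mem_is_rgf _ w_rgf) mem_iota add1n ltnS.
apply/containsP; exists (iota 1 m).
  apply: subseq_trans (iota_wmax_subseq w_rgf).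
  by rewrite -(subnKC mw) iotaD prefix_subseq.
by rewrite std_sorted ?size_iota // iota_ltn_sorted.
Qed.

(** The Stirling number of the second kind S(n, k), since the maximum is the number of blocks. *)
Definition wmax_count n k := count (fun w => wmax w == k) (rgf_words n).

(** The recurrence S(n+1, j) = j S(n, j) + S(n, j-1) in the form of a matrix product. Truncation at
    [m] loses nothing because appending a letter never lowers the maximum. *)
Lemma wmax_countS m n j : j < m ->
  wmax_count n.+1 j = \sum_(i < m) wmax_count n i * ((i == j :> nat) * j + (i.+1 == j)).
Proof.
move=> jm; rewrite /wmax_count -sum1_count big_mkcond big_allpairs_dep.
under [RHS]eq_bigr => i _ do rewrite -sum1_count big_mkcond big_distrl /=.
rewrite exchange_big; apply: eq_bigr => w _.
under eq_bigr => a _ do rewrite wmax_rcons.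
(* For a fixed [w], the letters 1, ..., [wmax w] keep the maximum and the one remaining letter
   raises it by 1. *)
transitivity ((wmax w == j) * j + ((wmax w).+1 == j)).
  rewrite -big_mkcond sum1_count -[(wmax w).+1 in LHS]addn1 iotaD count_cat /=.
  rewrite addn0 add1n (maxn_idPr (leqnSn _)); congr (_ + _).
  rewrite (@eq_in_count _ _ (fun=> wmax w == j)); last first.
    by move=> a; rewrite mem_iota => a_bnd; congr (_ == _); lia.
  by case: eqP => [->|]; rewrite ?count_predT ?size_iota ?mul1n // count_pred0.
case: (ltnP (wmax w) m) => wm.
  rewrite (bigD1 (Ordinal wm)) //= eqxx mul1n big1 ?addn0 // => i.
  by rewrite eq_sym -val_eqE /= => /negbTE->.
by rewrite big1 ?addn0 => [|i _]; [lia | case: eqP => // wi; have := ltn_ord i; lia].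
Qed.

(** * Partitions into small blocks *)

(** The ground set is a subset of an arbitrary type, so that deleting a block stays within the same
    type. *)
Definition small_parts (T : finType) d (A : {set T}) : {set {set {set T}}} :=
  [set P | partition P A & [forall (B | B \in P), #|B| <= d]].

Lemma small_parts0 (T : finType) d : #|small_parts d (set0 : {set T})| = 1.
Proof.
apply/eqP/cards1P; exists set0; apply/setP => P; rewrite !inE partition_set0.
by case: eqP => // ->; apply/forall_inP => B; rewrite inE.
Qed.

(** Deleting the block [B] and adding it back are inverse bijections. *)
Lemma card_small_parts_block (T : finType) d (A B : {set T}) x :
  x \in B -> B \subset A -> #|B| <= d ->
  #|[set P in small_parts d A | pblock P x == B]| = #|small_parts d (A :\: B)|.
Proof.
move=> xB sBA Bd; have B_neq0 : B != set0 by apply/set0Pn; exists x.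
have notin Q : Q \in small_parts d (A :\: B) -> B \notin Q.
  rewrite inE => /andP[partQ _]; apply/negP => /(partitionS partQ)/subsetP/(_ x xB).
  by rewrite inE xB.
rewrite -[RHS](@card_in_imset _ _ (fun Q => B |: Q)) => [|Q Q' QP QP' eQ]; last first.
  by rewrite -(setU1K (notin _ QP)) eQ (setU1K (notin _ QP')).
apply: eq_card => P; rewrite !inE; apply/andP/imsetP => [[]|[Q QP ->]].
  move=> /andP[partP /forall_inP Pd] /eqP Px.
  have PB : B \in P by rewrite -Px pblock_mem // (cover_partition partP) (subsetP sBA).
  exists (P :\ B); last by rewrite setD1K.
  rewrite inE partitionD1 //; apply/forall_inP => C; rewrite !inE => /andP[_ CP].
  exact: Pd.
move: (QP); rewrite inE => /andP[partQ /forall_inP Qd].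
have partBQ : partition (B |: Q) A.
  have := partitionU1 partQ B_neq0; rewrite setDE setUIr setUCr setIT.
  rewrite (setUidPr sBA); apply; rewrite -setDE disjoint_sym.
  by rewrite disjoints_subset setDE subsetIr.
rewrite partBQ; split; last first.
  by rewrite (def_pblock (partition_trivIset partBQ) _ xB) // setU11.
by apply/forall_inP => C; rewrite !inE => /orP[/eqP -> //|]; apply: Qd.
Qed.

Lemma card_small_parts_rec (T : finType) d (A : {set T}) x : x \in A ->
  #|small_parts d A| =
  \sum_(B : {set T} | [&& x \in B, B \subset A & #|B| <= d]) #|small_parts d (A :\: B)|.
Proof.
move=> xA; rewrite -sum1_card (partition_big (fun P => pblock P x)
  (fun B : {set T} => [&& x \in B, B \subset A & #|B| <= d])) /= => [|P].
  apply: eq_bigr => B /and3P[xB sBA Bd]; rewrite -(card_small_parts_block xB sBA Bd).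
  by rewrite -sum1_card; apply: eq_bigl => P; rewrite !inE.
rewrite inE => /andP[partP /forall_inP Pd].
have xP : x \in cover P by rewrite (cover_partition partP).
by rewrite mem_pblock xP (partitionS partP) ?pblock_mem //= Pd // pblock_mem.
Qed.

Lemma card_pointed_draws (T : finType) (A : {set T}) x j : x \in A ->
  #|[set B : {set T} | [&& x \in B, B \subset A & #|B| == j.+1]]| = 'C(#|A|.-1, j).
Proof.
move=> xA; have -> : #|A|.-1 = #|A :\ x| by rewrite (cardsD1 x A) xA.
rewrite -cards_draws -[RHS](@card_in_imset _ _ (fun C => x |: C)) => [|C C']; last first.
  rewrite !inE !subsetD1 => /andP[/andP[_ xC] _] /andP[/andP[_ xC'] _] eC.
  by rewrite -(setU1K xC) eC setU1K.
apply: eq_card => B; rewrite inE; apply/and3P/imsetP => [[xB sBA Bj]|[C]].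
  exists (B :\ x); last by rewrite setD1K.
  by rewrite inE setSD //=; move: Bj; rewrite (cardsD1 x B) xB.
rewrite inE subsetD1 => /andP[/andP[sCA xC] Cj] ->.
by rewrite setU11 subUset sub1set xA sCA cardsU1 xC (eqP Cj).
Qed.

Lemma sum_pointed_draws (T : finType) d (A : {set T}) x (G : nat -> nat) : x \in A ->
  \sum_(B : {set T} | [&& x \in B, B \subset A & #|B| <= d]) G #|B|
  = \sum_(j < d) 'C(#|A|.-1, j) * G j.+1.
Proof.
move=> xA; case: d => [|d].
  rewrite big_ord0 big1 // => B /and3P[xB _]; rewrite leqn0 cards_eq0 => /eqP B0.
  by rewrite B0 inE in xB.
(* Every [B] contains [x], so its size is positive and is indexed by the number of its other
   elements. *)
rewrite (partition_big (fun B : {set T} => inord #|B|.-1 : 'I_d.+1) xpredT) //=.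
apply: eq_bigr => j _; rewrite -(card_pointed_draws j xA) -sum1_card big_distrl /=.
have cardB (B : {set T}) : x \in B -> #|B| = #|B|.-1.+1.
  by move=> xB; rewrite prednK //; apply/card_gt0P; exists x.
apply: eq_big => [B|B].
  rewrite !inE; case xB: (x \in B) => //=; case: (B \subset A) => //=.
  rewrite (cardB B xB) ltnS eqSS; case: leqP => Bd /=.
    by rewrite -val_eqE /= inordK.
  by apply/esym/eqP => eB; have := ltn_ord j; rewrite -eB ltnS leqNgt Bd.
move=> /andP[/and3P[xB _ Bd] /eqP <-]; rewrite inordK ?mul1n -?cardB //.
Qed.

Definition small_bell d n := #|small_parts d [set: 'I_n]|.

(** Strong induction on the cardinality, with the type generalized: [recE] is applied both to [A]
    and to the full set of ['I_#|A|], and its right-hand side depends only on [#|A|]. *)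
Lemma card_small_parts (T : finType) d (A : {set T}) :
  #|small_parts d A| = small_bell d #|A|.
Proof.
have [n] := ubnP #|A|; elim: n => // n IHn in T A *; rewrite ltnS => An.
have recE (S : finType) (D : {set S}) x : x \in D -> #|D| = #|A| ->
    #|small_parts d D| = \sum_(j < d) 'C(#|A|.-1, j) * small_bell d (#|A| - j.+1).
  move=> xD DA; rewrite (card_small_parts_rec _ xD) -DA.
  rewrite -(sum_pointed_draws _ (fun b => small_bell d (#|D| - b)) xD).
  apply: eq_bigr => B /and3P[xB sBD Bd]; rewrite IHn cardsDS //.
  have : 0 < #|B| by apply/card_gt0P; exists x.
  by have := subset_leq_card sBD; lia.
have [A0|] := eqVneq A set0.
  rewrite A0 cards0 small_parts0 /small_bell.
  have -> : [set: 'I_0] = set0 by apply/setP => -[].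
  by rewrite small_parts0.
move=> /set0Pn[x xA]; rewrite (recE _ _ _ xA) //.
have A_gt0 : 0 < #|A| by apply/card_gt0P; exists x.
by rewrite -(@recE _ setT (Ordinal A_gt0)) ?inE // cardsT card_ord.
Qed.

Lemma small_bellS d n :
  small_bell d n.+1 = \sum_(j < d) 'C(n, j) * small_bell d (n - j).
Proof.
rewrite {1}/small_bell (@card_small_parts_rec _ d _ ord0) ?inE //.
under eq_bigr => B /and3P[_ sB _]
  do rewrite card_small_parts cardsDS // cardsT card_ord.
rewrite (sum_pointed_draws _ (fun b => small_bell d (n.+1 - b))) ?inE //.
by apply: eq_bigr => j _; rewrite cardsT card_ord subSS.
Qed.

Lemma count_rgf n (P : {set {set 'I_n}}) (i : 'I_n) : partition P [set: 'I_n] ->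
  count_mem (nth 0 (rgf P) i) (rgf P) = #|pblock P i|.
Proof.
move=> partP; have rgf_nth : rgf P = [seq nth 0 (rgf P) j | j : 'I_n <- enum 'I_n].
  by apply: eq_map => j; rewrite nth_rgf.
rewrite [in X in count _ X]rgf_nth count_map -sum1_count big_enum_cond -sum1_card.
apply: eq_bigl => j /=.
rewrite eq_sym nth_rgf_eq // (eq_pblock _ (partition_trivIset partP)) //.
exact: in_cover_all.
Qed.

Lemma card_R_one_block n d : #|R_n n (one_block_part d.+1)| = small_bell d n.
Proof.
apply: eq_card => P; rewrite !inE; case partP: (partition _ _) => //=.
rewrite rgf_one_block //; apply/idP/forall_inP => [av B BP|Pd].
  rewrite leqNgt; apply: contra av => Bd; apply/contains_nseq => //.
  have /set0Pn[i iB] := partition_neq0 partP BP.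
  exists (nth 0 (rgf P) i); rewrite count_rgf //.
  by rewrite (def_pblock (partition_trivIset partP) BP iB).
apply/negP => /contains_nseq[] // x; have [xw|/count_memPn -> //] := boolP (x \in rgf P).
have /(nthP 0)[i] := xw; rewrite size_rgf => ilt <-.
rewrite (count_rgf (Ordinal ilt)) // => dP.
have := Pd (pblock P (Ordinal ilt)); rewrite pblock_mem ?in_cover_all //.
by move=> /(_ isT); rewrite leqNgt dP.
Qed.

(** * The patterns 112, 121 and 122 *)

(** An occurrence either misses the last letter or ends at it. *)
Lemma subseq_rcons2 (T : eqType) (s w : seq T) x y :
  subseq (rcons s x) (rcons w y) = subseq (rcons s x) w || (x == y) && subseq s w.
Proof.
apply/idP/orP => [|[sw|/andP[/eqP -> sw]]]; last 2 first.
- exact: subseq_trans (subseq_rcons _ _).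
- by rewrite -!cats1 cat_subseq.
rewrite -subseq_rev !rev_rcons /= -[subseq s w]subseq_rev.
rewrite -[subseq _ w]subseq_rev rev_rcons.
by case: eqP => [->|_]; [right | left].
Qed.

(** The images of [f] and [g] on avoiding words are disjoint and together give all avoiding words
    one letter longer. Lengths start at 1, as the empty word has a single child. *)
Lemma count_doubling (av : pred (seq nat)) (f g : seq nat -> seq nat) n :
  (forall w, is_rgf w -> size w = n.+1 -> av w ->
     [&& is_rgf (f w), size (f w) == n.+2 & av (f w)]) ->
  (forall w, is_rgf w -> size w = n.+1 -> av w ->
     [&& is_rgf (g w), size (g w) == n.+2 & av (g w)]) ->
  (forall w, is_rgf w -> size w = n.+2 -> av w ->
     exists v, [&& is_rgf v, size v == n.+1 & av v] /\ (w = f v \/ w = g v)) ->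
  injective f -> injective g ->
  (forall v w, is_rgf v -> is_rgf w -> size v = n.+1 -> size w = n.+1 -> f v <> g w) ->
  count av (rgf_words n.+2) = 2 * count av (rgf_words n.+1).
Proof.
move=> fP gP fgP f_inj g_inj f_neq_g; set F := filter av (rgf_words n.+1).
have memF w : (w \in F) = [&& is_rgf w, size w == n.+1 & av w].
  by rewrite mem_filter mem_rgf_words andbC andbA.
have F_uniq : uniq F by rewrite filter_uniq ?rgf_words_uniq.
have -> : 2 * count av (rgf_words n.+1) = size (map f F ++ map g F).
  by rewrite size_cat !size_map -size_filter -/F mul2n addnn.
rewrite -size_filter; apply/perm_size/uniq_perm.
- by rewrite filter_uniq ?rgf_words_uniq.
- rewrite cat_uniq !map_inj_uniq // F_uniq /= andbT; apply/hasPn => _ /mapP[w wF ->].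
  apply/negP => /mapP[v vF /esym].
  move: vF wF; rewrite !memF => /and3P[? /eqP ? _] /and3P[? /eqP ? _].
  exact: f_neq_g.
move=> w; rewrite mem_filter mem_rgf_words mem_cat.
apply/and3P/orP => [[av_w w_rgf /eqP sz_w]|].
  have [v [vF [->|->]]] := fgP w w_rgf sz_w av_w; [left|right];
  by apply/mapP; exists v; rewrite ?memF.
case=> /mapP[v]; rewrite memF => /and3P[v_rgf /eqP sz_v av_v] ->.
  by have /and3P[] := fP v v_rgf sz_v av_v.
by have /and3P[] := gP v v_rgf sz_v av_v.
Qed.

Lemma wmax_gt0 w n : is_rgf w -> size w = n.+1 -> 0 < wmax w.
Proof.
case: w => // a w w_rgf _; have := mem_is_rgf a w_rgf.
by rewrite mem_head => /esym/andP[a_gt0 aM]; apply: leq_trans a_gt0 aM.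
Qed.

Lemma rcons_last_inj (f : seq nat -> nat) : injective (fun w => rcons w (f w)).
Proof. by move=> v w /rcons_inj[]. Qed.

Lemma contains121_rcons w a : is_rgf (rcons w a) ->
  contains (rcons w a) [:: 1; 2; 1] = contains w [:: 1; 2; 1] || (a < wmax w).
Proof.
rewrite is_rgf_rcons => /andP[w_rgf /andP[a_gt0 aM]]; apply/idP/orP.
  move=> /contains121[x [y [xy]]]; rewrite -[[:: _; _; _]]/(rcons [:: x; y] x).
  rewrite subseq_rcons2 => /orP[sw|/andP[/eqP <- /mem_subseq sw]].
    by left; apply/contains121; exists x, y.
  right; have: y \in w by apply: sw; rewrite !inE eqxx orbT.
  by rewrite (mem_is_rgf _ w_rgf) => /andP[_]; apply: leq_trans.
case=> [|lt_a]; first exact/contains_subseq/subseq_rcons.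
apply/contains121; exists a, (wmax w); split=> //.
rewrite -[[:: _; _; _]]/(rcons [:: a; wmax w] a) subseq_rcons2 eqxx /=.
apply/orP; right; apply: subseq_trans (iota_wmax_subseq w_rgf).
(* Cutting 1, ..., [wmax w] just after [a] puts [a] in the left part and the maximum in the right
   part. *)
rewrite -(subnKC (ltnW lt_a)) iotaD.
rewrite -[X in subseq X _]/([:: a] ++ [:: a + (wmax w - a)]).
by apply: cat_subseq; rewrite sub1seq mem_iota; lia.
Qed.

Lemma count_avoid121 n :
  count (fun w => ~~ contains w [:: 1; 2; 1]) (rgf_words n.+2)
  = 2 * count (fun w => ~~ contains w [:: 1; 2; 1]) (rgf_words n.+1).
Proof.
apply: (@count_doubling _ (fun w => rcons w (wmax w)) (fun w => rcons w (wmax w).+1)).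
- move=> w w_rgf sz_w av_w; have M_gt0 := wmax_gt0 w_rgf sz_w.
  have wM_rgf : is_rgf (rcons w (wmax w)) by rewrite is_rgf_rcons w_rgf M_gt0 /=.
  by rewrite wM_rgf size_rcons sz_w eqxx contains121_rcons // (negbTE av_w) ltnn.
- move=> w w_rgf sz_w av_w.
  have wM_rgf : is_rgf (rcons w (wmax w).+1) by rewrite is_rgf_rcons w_rgf /=.
  rewrite wM_rgf size_rcons sz_w eqxx contains121_rcons // (negbTE av_w) /=.
  by rewrite ltnNge leqnSn.
- case/lastP=> [|w a] // wa_rgf; rewrite size_rcons => -[sz_w].
  rewrite contains121_rcons // negb_or -leqNgt => /andP[av_w Ma]; exists w.
  move: wa_rgf; rewrite is_rgf_rcons => /andP[w_rgf /andP[_ aM]].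
  rewrite w_rgf sz_w eqxx av_w; split=> //.
  have [->|->] : a = wmax w \/ a = (wmax w).+1 by lia.
    by left.
  by right.
- exact: rcons_last_inj.
- exact: rcons_last_inj.
move=> v w _ _ _ _ /rcons_inj[-> /eqP]; by rewrite -[_ == _]negbK neq_ltn leqnn.
Qed.

(** A new occurrence ends in a repeated letter, hence [a <= wmax w], with a smaller letter before
    it; the letter 1 serves as soon as [1 < a]. *)
Lemma contains122_rcons w n a : is_rgf (rcons w a) -> size w = n.+1 ->
  contains (rcons w a) [:: 1; 2; 2] = contains w [:: 1; 2; 2] || (1 < a <= wmax w).
Proof.
rewrite is_rgf_rcons => /andP[w_rgf /andP[a_gt0 aM]] sz_w; apply/idP/orP.
  move=> /contains122[x [y [xy]]]; rewrite -[[:: _; _; _]]/(rcons [:: x; y] y).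
  rewrite subseq_rcons2 => /orP[sw|/andP[/eqP <- /mem_subseq sw]].
    by left; apply/contains122; exists x, y.
  right; have: x \in w by apply: sw; rewrite !inE eqxx.
  have: y \in w by apply: sw; rewrite !inE eqxx orbT.
  by rewrite !(mem_is_rgf _ w_rgf); lia.
case=> [|/andP[lt_a le_a]]; first exact/contains_subseq/subseq_rcons.
apply/contains122; exists 1, a; split=> //.
rewrite -[[:: _; _; _]]/(rcons [:: 1; a] a) subseq_rcons2 eqxx /=.
apply/orP; right; apply: subseq_trans (iota_wmax_subseq w_rgf).
rewrite -(subnKC (ltnW (leq_trans lt_a le_a))) iotaD.
rewrite -[X in subseq X _]/([:: 1] ++ [:: a]).
by apply: cat_subseq; rewrite sub1seq mem_iota; lia.
Qed.

Lemma count_avoid122 n :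
  count (fun w => ~~ contains w [:: 1; 2; 2]) (rgf_words n.+2)
  = 2 * count (fun w => ~~ contains w [:: 1; 2; 2]) (rgf_words n.+1).
Proof.
apply: (@count_doubling _ (rcons^~ 1) (fun w => rcons w (wmax w).+1)).
- move=> w w_rgf sz_w av_w.
  have w1_rgf : is_rgf (rcons w 1) by rewrite is_rgf_rcons w_rgf.
  by rewrite w1_rgf size_rcons sz_w eqxx (contains122_rcons w1_rgf sz_w) (negbTE av_w).
- move=> w w_rgf sz_w av_w.
  have wM_rgf : is_rgf (rcons w (wmax w).+1) by rewrite is_rgf_rcons w_rgf /=.
  rewrite wM_rgf size_rcons sz_w eqxx (contains122_rcons wM_rgf sz_w) (negbTE av_w) /=.
  by rewrite ltnn andbF.
- case/lastP=> [|w a] // wa_rgf; rewrite size_rcons => -[sz_w].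
  rewrite (contains122_rcons wa_rgf sz_w) negb_or => /andP[av_w Ma]; exists w.
  move: wa_rgf; rewrite is_rgf_rcons => /andP[w_rgf /andP[a_gt0 aM]].
  rewrite w_rgf sz_w eqxx av_w; split=> //.
  have [->|->] : a = 1 \/ a = (wmax w).+1 by lia.
    by left.
  by right.
- by move=> v w /rcons_inj[].
- exact: rcons_last_inj.
move=> v w _ w_rgf _ sz_w /rcons_inj[_ M0].
by have := wmax_gt0 w_rgf sz_w; rewrite -M0.
Qed.

(** A final 1 completes no occurrence, since no letter is smaller, and an initial 1 that never
    recurs starts none. Conversely, if an avoiding word ends in [a] other than 1, a second 1 would
    form 112 with [a], so 1 occurs only in front. *)
Lemma count_avoid112 n :
  count (fun w => ~~ contains w [:: 1; 1; 2]) (rgf_words n.+2)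
  = 2 * count (fun w => ~~ contains w [:: 1; 1; 2]) (rgf_words n.+1).
Proof.
apply: (@count_doubling _ (rcons^~ 1) (fun w => 1 :: map S w)).
- move=> w w_rgf sz_w av_w; rewrite is_rgf_rcons w_rgf size_rcons sz_w eqxx /=.
  apply: contra av_w => /contains112[x [y [xy]]].
  rewrite -[[:: _; _; _]]/(rcons [:: x; x] y) subseq_rcons2.
  case/orP=> [sw|/andP[/eqP ey /mem_subseq sw]].
    by apply/contains112; exists x, y.
  have: x \in w by apply: sw; rewrite !inE eqxx.
  by rewrite (mem_is_rgf _ w_rgf); lia.
- move=> w w_rgf sz_w av_w; rewrite /= (is_rgf_mapS _ (is_rgf_pos w_rgf)) w_rgf.
  rewrite size_map sz_w eqxx /=; apply: contra av_w => /contains112[x [y [xy]]].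
  have not1 z : z \in map S w -> 1 < z.
    by move=> /mapP[u uw ->]; move: uw; rewrite (mem_is_rgf _ w_rgf) ltnS => /andP[].
  rewrite /=; case: eqP => [-> /mem_subseq sw|_ sw].
    by have := not1 1 (sw 1 (mem_head _ _)).
  suff: contains (map S w) [:: 1; 1; 2].
    move=> /containsP[t /subseqP[m sz_m ->]]; rewrite -map_mask std_map // => tE.
    by apply/containsP; exists (mask m w); rewrite ?mask_subseq.
  by apply/contains112; exists x, y.
- case/lastP=> [|w a] // wa_rgf; rewrite size_rcons => -[sz_w] av_wa.
  move: (wa_rgf); rewrite is_rgf_rcons => /andP[w_rgf /andP[a_gt0 aM]].
  have [a1|a_neq1] := eqVneq a 1.
    exists w; rewrite w_rgf sz_w eqxx a1; split; last by left.
    by apply: contra av_wa; apply/contains_subseq/subseq_rcons.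
  case: w => [|b w] // in sz_w wa_rgf av_wa w_rgf aM *.
  have b1 : b = 1 by move: w_rgf; rewrite /= max0n; case: (b) => [|[]].
  rewrite b1 in wa_rgf av_wa *; case: sz_w => sz_w.
  have pos : all (leq 1) (rcons w a) by exact: is_rgf_pos wa_rgf.
  have notin1 : 1 \notin w.
    apply: contra av_wa => w1; apply/contains112; exists 1, a; split; first by lia.
    change (is_true (subseq ([:: 1] ++ [:: a]) (rcons w a))).
    by rewrite -cats1; apply: cat_subseq; rewrite sub1seq ?mem_head.
  (* The preimage under the second map: drop the initial 1 and lower the other letters, all at least
     2. *)
  pose v := map predn (rcons w a).
  have vE : map S v = rcons w a.
    rewrite -map_comp -[RHS]map_id; apply/eq_in_map => x /(allP pos) /=.
    by case: x.
  have v_pos : all (leq 1) v.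
    rewrite all_map; apply/allP => x xw /=; have := allP pos _ xw.
    have: x != 1.
      move: xw; rewrite mem_rcons inE => /orP[/eqP -> //|].
      by apply: contraL => /eqP ->.
    by lia.
  have v_rgf : is_rgf v by move: wa_rgf; rewrite /= -vE is_rgf_mapS.
  exists v; rewrite v_rgf size_map size_rcons sz_w eqxx /=; split; last first.
    by right; rewrite vE.
  apply: contra av_wa => /containsP[t /subseqP[m sz_m ->] tE].
  apply/containsP; exists (mask m (map S v)); last by rewrite -map_mask std_map.
  by rewrite vE; apply: subseq_trans (mask_subseq _ _) (subseq_cons _ _).
- by move=> v w /rcons_inj[].
- by move=> v w [] /inj_map; apply; apply: succn_inj.
(* The images are disjoint: the first map gives last letter 1, the second a last letter of at least
   2. *)
move=> v w v_rgf w_rgf sz_v sz_w /(congr1 (last 0)).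
rewrite last_rcons /=; case/lastP: w => [|w a] // in w_rgf sz_w *.
rewrite map_rcons last_rcons => -[a0].
by have := allP (is_rgf_pos w_rgf) a; rewrite mem_rcons mem_head -a0 => /(_ isT).
Qed.

(** * P-recursiveness *)

Local Open Scope ring_scope.

(* By Cayley-Hamilton, the characteristic polynomial of A is a recurrence. *)
Lemma P_recursive_matrix m (A : 'M[rat]_m.+1) (u : 'rV_m.+1) (v : 'cV_m.+1) a :
  (forall n, (a n)%:R = (u *m A ^+ n *m v) 0 0) -> P_recursive a.
Proof.
move=> aE; exists m.+1, (fun i => ((char_poly A)`_i)%:P); split.
  exists m.+1 => //; rewrite polyC_eq0.
  have := monicP (char_poly_monic A); rewrite lead_coefE size_char_poly /= => ->.
  exact: oner_neq0.
move=> n; under eq_bigr => i _ do rewrite hornerC aE exprD.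
have CH : \sum_(i < m.+2) (char_poly A)`_i *: A ^+ i = 0.
  rewrite -[RHS](Cayley_Hamilton A) -[in RHS](coefK (char_poly A)) size_char_poly.
  rewrite poly_def rmorph_sum; apply: eq_bigr => i _ /=.
  by rewrite horner_mxZ rmorphXn /= horner_mx_X.
have uv0 : (u *m (A ^+ n *m (\sum_(i < m.+2) (char_poly A)`_i *: A ^+ i)) *m v) 0 0 = 0.
  by rewrite CH !(mulmx0, mul0mx) mxE.
rewrite -[RHS]uv0 !(mulmx_sumr, mulmx_suml) summxE; apply: eq_bigr => i _.
by rewrite -!(scalemxAr, scalemxAl) [RHS]mxE.
Qed.

Lemma P_recursive_wmax m :
  P_recursive (fun n => count (fun w => wmax w <= m)%N (rgf_words n)).
Proof.
(* [A] is the transition matrix of [wmax_countS]; the all-ones column used below sums over the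
   maxima 0, ..., [m]. *)
pose A := \matrix_(i < m.+1, j < m.+1)
  ((i == j :> nat) * j + (i.+1 == j))%N%:R : 'M[rat]_m.+1.
pose c n : 'rV[rat]_m.+1 := \row_(j < m.+1) (wmax_count n j)%:R.
have cE n : c n = c 0%N *m A ^+ n.
  elim: n => [|n IHn]; first by rewrite expr0 mulmx1.
  rewrite exprSr mulmxA -IHn; apply/rowP => j; rewrite !mxE.
  rewrite (wmax_countS _ (ltn_ord j)) natr_sum; apply: eq_bigr => i _.
  by rewrite !mxE natrM.
apply: (@P_recursive_matrix _ A (c 0%N) (const_mx 1)) => n.
rewrite -cE mxE; under eq_bigr => i _ do rewrite !mxE mulr1.
rewrite -natr_sum; congr _%:R; rewrite /wmax_count.
under eq_bigr => i _ do rewrite -sum1_count big_mkcond /=.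
rewrite exchange_big -sum1_count big_mkcond /=; apply: eq_bigr => w _.
case: leqP => wm.
  rewrite (bigD1 (Ordinal (wm : wmax w < m.+1)%N)) //= eqxx big1 // => i.
  by rewrite eq_sym -val_eqE /= => /negbTE->.
by rewrite big1 // => i _; case: eqP => // wi; have := ltn_ord i; lia.
Qed.

Lemma P_recursive_ext a b : (forall n, a n = b n) -> P_recursive a -> P_recursive b.
Proof.
move=> eab [k [P [P_neq0 recP]]]; exists k, P; split=> // n.
by under eq_bigr => i _ do rewrite -eab.
Qed.

Lemma P_recursive_discrete m : (0 < m)%N ->
  P_recursive (fun n => #|R_n n (discrete_part m)|).
Proof.
case: m => // m _; apply: P_recursive_ext (P_recursive_wmax m) => n.
rewrite card_R_n rgf_discrete; apply: eq_in_count => w.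
by rewrite mem_rgf_words => /andP[w_rgf _]; rewrite contains_iota // -leqNgt.
Qed.

(** The binomial coefficient C(n+c, j) as a polynomial in n, built from (j+1) C(N, j+1) = (N-j) C(N,
    j). *)
Fixpoint bin_poly (c j : nat) : {poly rat} :=
  if j is j'.+1 then
    (j%:R^-1)%:P * ('X + (c%:R - j'%:R)%:P) * bin_poly c j'
  else 1.

Lemma horner_bin_poly c j n : (bin_poly c j).[n%:R] = 'C(n + c, j)%:R.
Proof.
elim: j => [|j IHj]; first by rewrite hornerC bin0.
rewrite [bin_poly _ _]/= !hornerM IHj !(hornerD, hornerX, hornerC).
have j_neq0 : j.+1%:R != 0 :> rat by rewrite pnatr_eq0.
apply: (mulfI j_neq0); rewrite !mulrA mulfV // mul1r -natrM mul_bin_left natrM.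
(* When [n + c < j] the natural subtraction truncates, but then ['C(n + c, j)] is 0 and both sides
   vanish. *)
have [le_j|lt_j] := leqP j (n + c); first by rewrite natrB // natrD addrA.
by rewrite bin_small ?mulr0.
Qed.

Lemma P_recursive_one_block m : (0 < m)%N ->
  P_recursive (fun n => #|R_n n (one_block_part m)|).
Proof.
case: m => // d _; apply: (@P_recursive_ext (small_bell d)) => [n|].
  by rewrite card_R_one_block.
(* This is [small_bellS] at [n + d], a shift that prevents truncation in its indices; the summand
   [j] falls on a(n+i) with i = d-j, which is never 0. *)
exists d.+1, (fun i => if i == d.+1 then 1 else
   if i == 0%N then 0 else - bin_poly d (d - i)); split.
  by exists d.+1; rewrite // eqxx oner_neq0.
move=> n; rewrite big_ord_recr big_ord_recl /= eqxx horner0 mul0r add0r hornerC mul1r.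
rewrite natrDE addnS small_bellS natr_sum (reindex_inj rev_ord_inj) /= -big_split.
rewrite big1 //= => i _.
rewrite /bump /= add1n -subSn // subSS eqn_leq [(d.+1 <= _)%N]ltnNge leq_subr andbF.
rewrite hornerN horner_bin_poly subKn; last by have := ltn_ord i; lia.
rewrite natrDE natrM addnBA; last by have := ltn_ord i; lia.
by rewrite mulNr addNr.
Qed.

Lemma P_recursive_double a : (forall n, a n.+2 = 2 * a n.+1)%N -> P_recursive a.
Proof.
(* Doubling holds only from index 1 on, so the recurrence has order two with coefficient 0 at
   a(n). *)
move=> aE; exists 2%N, (fun i => if i == 2%N then 1 else
  if i == 1%N then (- 2%:R)%:P else 0).
split; first by exists 2%N; rewrite //= oner_neq0.
move=> n; rewrite !big_ord_recr big_ord0 /= horner0 mul0r !add0r !hornerC.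
by rewrite !natrDE addn2 addn1 aE natrM mul1r mulNr addNr.
Qed.

Local Close Scope ring_scope.

Theorem theorem4p4 :
  (forall m : nat, 1 <= m ->
     P_recursive (fun n => #|R_n n (discrete_part m)|) /\
     P_recursive (fun n => #|R_n n (one_block_part m)|)) /\
  (forall pi : {set {set 'I_3}}, pi \in Pi_n 3 ->
     P_recursive (fun n => #|R_n n pi|)).
Proof.
split=> [m m_gt0|pi pi_part].
  by split; [apply: P_recursive_discrete | apply: P_recursive_one_block].
have : rgf pi \in rgf_words 3.
  by move: pi_part; rewrite inE mem_rgf_words => piP; rewrite rgf_is_rgf // size_rgf.
(* The five words of length 3 are, in this order, 111, 112, 121, 122, 123. *)
rewrite !inE => /or4P[|||/orP[]] /eqP pi_rgf.
- apply: P_recursive_ext (@P_recursive_one_block 3 isT) => n.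
  by rewrite !card_R_n rgf_one_block // pi_rgf.
- by apply: P_recursive_double => n; rewrite !card_R_n pi_rgf count_avoid112.
- by apply: P_recursive_double => n; rewrite !card_R_n pi_rgf count_avoid121.
- by apply: P_recursive_double => n; rewrite !card_R_n pi_rgf count_avoid122.
apply: P_recursive_ext (@P_recursive_discrete 3 isT) => n.
by rewrite !card_R_n rgf_discrete pi_rgf.
Qed.
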